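(* Let $T$ be a tree of order $n>10$ that is not isomorphic to the path $P_n$. Then for every integer $k$ with $2\le k\le n-2$, the graph $F_k(T)$ is non-planar.
   Context: For a simple graph $G=(V,E)$ on $n$ vertices and an integer $1\le k<n$, the $k$-token graph $F_k(G)$ is the graph whose vertices are all $k$-element subsets of $V$, two such subsets $A,B$ being adjacent whenever their symmetric difference $A\triangle B$ is a pair $\{a,b\}$ with $a$ adjacent to $b$ in $G$. *)

(* Defs.v *)
From mathcomp Require Import all_boot.
From Stdlib Require Import Reals.
Set Implicit Arguments. Unset Strict Implicit. Unset Printing Implicit Defensive.

Definition simple_graph (V : finType) (e : rel V) : Prop :=
  symmetric e /\ irreflexive e.

Definition acyclic (V : finType) (e : rel V) : Prop :=
  forall c : seq V, 3 <= size c -> uniq c -> ~~ cycle e c.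

Definition connected (V : finType) (e : rel V) : Prop :=
  forall x y : V, connect e x y.

Definition is_tree (V : finType) (e : rel V) : Prop :=
  simple_graph e /\ connected e /\ acyclic e.

Definition path_rel (n : nat) : rel 'I_n :=
  fun i j => (i.+1 == j :> nat) || (j.+1 == i :> nat).

Arguments path_rel n : clear implicits.

Definition isomorphic (V W : finType) (e : rel V) (f : rel W) : Prop :=
  exists g : V -> W, bijective g /\ forall x y, f (g x) (g y) = e x y.

Definition ksubset (V : finType) (k : nat) := {A : {set V} | #|A| == k}.

Definition token_rel (V : finType) (e : rel V) (k : nat) : rel (ksubset V k) :=
  fun A B => [exists a, exists b,
    e a b && ((val A :\: val B) :|: (val B :\: val A) == [set a; b])].

Arguments token_rel V e k : clear implicits.

Local Open Scope R_scope.

Definition in01 (t : R) : Prop := 0 <= t <= 1.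

Definition arc_continuous (f : R -> R * R) : Prop :=
  forall t, in01 t -> forall eps, 0 < eps -> exists delta, 0 < delta /\
    forall s, in01 s -> Rabs (s - t) < delta ->
      Rabs (fst (f s) - fst (f t)) < eps /\ Rabs (snd (f s) - snd (f t)) < eps.

Definition planar (V : finType) (e : rel V) : Prop :=
  exists (p : V -> R * R) (arc : V -> V -> R -> R * R),
    injective p /\
    (forall u v, e u v ->
       arc_continuous (arc u v) /\
       (forall s t, in01 s -> in01 t -> arc u v s = arc u v t -> s = t) /\
       arc u v 0 = p u /\ arc u v 1 = p v /\
       (forall t, in01 t -> arc v u t = arc u v (1 - t))) /\
    (forall u v w t, e u v -> 0 < t < 1 -> arc u v t <> p w) /\
    (forall u v x y s t, e u v -> e x y -> 0 < s < 1 -> 0 < t < 1 ->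
       arc u v s = arc x y t -> (u = x /\ v = y) \/ (u = y /\ v = x)).

(* Main.v *)
(* Let a graph be drawn in the plane with vertex x at p x. Record, modulo 4, the quadrant q x y of the
   vector p y - p x, and let th x a b be the number of quarter turns made by the arc ab as seen from x.
   Then th x a b = q x b - q x a modulo 4, while q x y and q y x differ by 2 modulo 4. If ab and cd are
   disjoint edges, then (s, t) |-> ab(s) - cd(t) has no zero on the unit square, so the turns along the
   boundary of the square add up to 0, which is a linear relation between four values of th. Both
   properties pass from edges to walks. Adding up the relations of the 18 pairs of independent edges
   of a K_{3,3} formed by walks gives a parity contradiction.

   A tree with more than 10 vertices that is not a path has a vertex with three neighbours. Adding one
   vertex at a time to this claw, one reaches one of five trees with at most 7 vertices whose 2-token
   graph contains such a K_{3,3}; otherwise the tree is a spider with three legs of length at most 3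
   and has at most 10 vertices. The remaining k - 2 tokens are parked outside the small tree; there is
   room for them after replacing k by n - k if necessary. *)

From Stdlib Require Import Reals Lra Lia ZArith ClassicalEpsilon.
From mathcomp Require Import all_boot zify.
From Coquelicot Require Compactness.
Require Import Defs.

Set Implicit Arguments. Unset Strict Implicit. Unset Printing Implicit Defensive.

Ltac mod_lia := intros; Z.to_euclidean_division_equations; lia.

(** * Quarter turns *)

Section Winding.
Local Open Scope R_scope.

Definition psub (p q : R * R) : R * R := (fst p - fst q, snd p - snd q).

(* Half-open quadrants, so that [quad (- p) = quad p + 2] modulo 4 for [p <> 0]. *)
Definition quad (p : R * R) : Z :=
  if Rlt_dec 0 (fst p) then (if Rle_dec 0 (snd p) then 0%Z else 3%Z)
  else if Rlt_dec 0 (snd p) then 1%Z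
  else if Rlt_dec (fst p) 0 then 2%Z
  else if Rlt_dec (snd p) 0 then 3%Z else 0%Z.

Lemma quad_bound p : (0 <= quad p <= 3)%Z.
Proof. by rewrite /quad; repeat (case: ifP || case: Rlt_dec || case: Rle_dec) => *; lia. Qed.

Lemma quad_opp p q : p <> q -> ((quad (psub p q) - quad (psub q p)) mod 4 = 2)%Z.
Proof.
case: p q => [a b] [c d] npq; rewrite /quad /psub /=.
repeat (case: Rlt_dec || case: Rle_dec) => * //=; try lra.
all: by exfalso; apply: npq; f_equal; lra.
Qed.

(** Excluding opposite quadrants makes the turn between the points unambiguous. *)
Definition adjacent (p q : R * R) : Prop := ((quad q - quad p) mod 4 <> 2)%Z.

(** A common open half-plane bounded by an axis: unlike lying in a given quadrant, this survives
    small perturbations. *)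
Definition same_side (p q : R * R) : Prop :=
  (0 < fst p /\ 0 < fst q) \/ (fst p < 0 /\ fst q < 0) \/
  (0 < snd p /\ 0 < snd q) \/ (snd p < 0 /\ snd q < 0).

Lemma same_side_adjacent p q : same_side p q -> adjacent p q.
Proof.
case: p q => [a b] [c d]; rewrite /same_side /adjacent /quad /=.
by repeat (case: Rlt_dec || case: Rle_dec) => * //=; lra.
Qed.

(* The representative of [quad q - quad p] in {-1, 0, 1, 2}; the value 2 does not occur for adjacent
   points. *)
Definition turn (p q : R * R) : Z := ((quad q - quad p + 1) mod 4 - 1)%Z.

Lemma turn_mod p q : ((turn p q - (quad q - quad p)) mod 4 = 0)%Z.
Proof. by rewrite /turn; have := quad_bound p; have := quad_bound q; mod_lia. Qed.

(** Three distinct quadrants include two opposite ones, so the four points occupy at most two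
    neighbouring quadrants, where [turn] is the difference of a height function. *)
Lemma turn_cell p q r s : adjacent p q -> adjacent p r -> adjacent p s ->
  adjacent q r -> adjacent q s -> adjacent r s ->
  (turn p q + turn q s = turn p r + turn r s)%Z.
Proof.
rewrite /adjacent /turn.
have := quad_bound p; have := quad_bound q; have := quad_bound r; have := quad_bound s.
by mod_lia.
Qed.

Lemma turn_opp p q r : p <> r -> q <> r ->
  turn (psub p r) (psub q r) = turn (psub r p) (psub r q).
Proof.
move=> /quad_opp + /quad_opp.
have := quad_bound (psub p r); have := quad_bound (psub q r).
have := quad_bound (psub r p); have := quad_bound (psub r q).
by rewrite /turn; mod_lia.
Qed.

Fixpoint zsum (F : nat -> Z) (n : nat) : Z :=
  if n is m.+1 then (zsum F m + F m)%Z else 0%Z.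

Lemma zsum_ext F G n : (forall i, (i < n)%N -> F i = G i) -> zsum F n = zsum G n.
Proof.
elim: n => //= n IH FG; rewrite FG // IH // => i lt_in.
by apply: FG; apply: ltnW.
Qed.

Definition winding (P : nat -> R * R) (n : nat) : Z :=
  zsum (fun i => turn (P i) (P i.+1)) n.

Lemma winding_mod P n : ((winding P n - (quad (P n) - quad (P 0%N))) mod 4 = 0)%Z.
Proof.
rewrite /winding; elim: n => [|n IH] /=; first by rewrite Z.sub_diag.
by have := turn_mod (P n) (P n.+1); mod_lia.
Qed.

(* All corners of a cell of the grid are pairwise adjacent, so the two ways around it agree. *)
Lemma winding_grid (H : nat -> nat -> R * R) m n :
  (forall i j i1 j1 i2 j2, (i < m)%N -> (j < n)%N ->
     (i <= i1 <= i.+1)%N -> (j <= j1 <= j.+1)%N -> (i <= i2 <= i.+1)%N -> (j <= j2 <= j.+1)%N ->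
     adjacent (H i1 j1) (H i2 j2)) ->
  (winding (fun i => H i 0%N) m + winding (H m) n =
   winding (H 0%N) n + winding (fun i => H i n) m)%Z.
Proof.
move=> adj; rewrite /winding.
(* The cells of one strip are added up, inner edges cancelling; the last induction adds the
   strips. *)
have step i : (i < m)%N ->
  (turn (H i 0%N) (H i.+1 0%N) + zsum (fun j => turn (H i.+1 j) (H i.+1 j.+1)) n =
   zsum (fun j => turn (H i j) (H i j.+1)) n + turn (H i n) (H i.+1 n))%Z.
  move=> lt_im; have: (n <= n)%N by [].
  elim: {-2}n => [|k IH] le_kn /=; first by lia.
  have := IH (ltnW le_kn).
  have A i1 j1 i2 j2 : (i <= i1 <= i.+1)%N -> (k <= j1 <= k.+1)%N ->
    (i <= i2 <= i.+1)%N -> (k <= j2 <= k.+1)%N -> adjacent (H i1 j1) (H i2 j2).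
    exact: adj.
  have := @turn_cell (H i k) (H i k.+1) (H i.+1 k) (H i.+1 k.+1).
  case; try by apply: A; rewrite ?leqnn ?leqnSn.
  by lia.
have: (m <= m)%N by [].
elim: {-2}m => [|k IH] le_km /=; first by lia.
by have := IH (ltnW le_km); have := step _ le_km; lia.
Qed.

End Winding.

(** * Sampling two disjoint arcs *)

Section Sampling.
Local Open Scope R_scope.

Definition arcs_apart (f g : R -> R * R) :=
  forall s t, in01 s -> in01 t -> f s <> g t.

Lemma same_side_locally f g s t : arc_continuous f -> arc_continuous g ->
  in01 s -> in01 t -> f s <> g t ->
  exists d : posreal, forall s1 t1 s2 t2, in01 s1 -> in01 t1 -> in01 s2 -> in01 t2 ->
    Rabs (s1 - s) < d -> Rabs (t1 - t) < d -> Rabs (s2 - s) < d -> Rabs (t2 - t) < d ->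
    same_side (psub (f s1) (g t1)) (psub (f s2) (g t2)).
Proof.
move=> cf cg s01 t01 nfg.
(* Some coordinate of the difference has absolute value [E]; it keeps its sign while each arc moves
   by less than [E / 2]. *)
pose E := Rmax (Rabs (fst (f s) - fst (g t))) (Rabs (snd (f s) - snd (g t))).
have E0 : 0 < E / 2.
  suff: 0 < E by lra.
  apply: Rnot_le_lt => E0.
  have := Rmax_l (Rabs (fst (f s) - fst (g t))) (Rabs (snd (f s) - snd (g t))).
  have := Rmax_r (Rabs (fst (f s) - fst (g t))) (Rabs (snd (f s) - snd (g t))).
  rewrite -/E => h1 h2; apply: nfg.
  rewrite [f s]surjective_pairing [g t]surjective_pairing.
  move: h1 h2; rewrite /Rabs; do 2 case: Rcase_abs => ?; move=> *; f_equal; lra.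
have [d1 [d1_gt0 df]] := cf s s01 _ E0; have [d2 [d2_gt0 dg]] := cg t t01 _ E0.
have d0 : 0 < Rmin d1 d2 by apply: Rmin_glb_lt.
exists (mkposreal _ d0) => s1 t1 s2 t2 s101 t101 s201 t201 /= hs1 ht1 hs2 ht2.
have [l1 l2] := (Rmin_l d1 d2, Rmin_r d1 d2).
have [|x1 y1] := df s1 s101; first by lra.
have [|x2 y2] := dg t1 t101; first by lra.
have [|x3 y3] := df s2 s201; first by lra.
have [|x4 y4] := dg t2 t201; first by lra.
move: x1 y1 x2 y2 x3 y3 x4 y4; rewrite /same_side /psub /=.
have: E = Rabs (fst (f s) - fst (g t)) \/ E = Rabs (snd (f s) - snd (g t)).
  by rewrite /E /Rmax; case: Rle_dec; [right|left].
move: E0; move: (E) => e E0 [] He.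
  move=> /Rabs_def2 ? _ /Rabs_def2 ? _ /Rabs_def2 ? _ /Rabs_def2 ? _.
  move: He; rewrite /Rabs; case: Rcase_abs => ? ?; [right; left|left]; lra.
move=> _ /Rabs_def2 ? _ /Rabs_def2 ? _ /Rabs_def2 ? _ /Rabs_def2 ?.
move: He; rewrite /Rabs; case: Rcase_abs => ? ?; [right; right; right|right; right; left]; lra.
Qed.

Definition node (N i : nat) : R := INR i / INR N.

Lemma node01 N i : (i <= N)%N -> (0 < N)%N -> in01 (node N i).
Proof.
move=> /leP/le_INR le_iN /ltP/lt_0_INR N_gt0; rewrite /node; have := pos_INR i.
move=> i_ge0; split; first by apply: Rmult_le_pos => //; apply/Rlt_le/Rinv_0_lt_compat.
by apply: (Rmult_le_reg_r (INR N)) => //; rewrite /Rdiv Rmult_assoc Rinv_l; lra.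
Qed.

Lemma node_ends N : (0 < N)%N -> node N 0 = 0 /\ node N N = 1.
Proof.
move=> /ltP/lt_0_INR N_gt0; rewrite /node; split; first exact: Rmult_0_l.
by apply: Rinv_r; lra.
Qed.

(* Uniformity comes from a Lebesgue number of the covering of the square given by
   [same_side_locally]. *)
Lemma same_side_fine f g : arc_continuous f -> arc_continuous g -> arcs_apart f g ->
  exists N0 : nat, forall N, (N0 <= N)%N -> forall i j i1 j1 i2 j2, (i < N)%N -> (j < N)%N ->
     (i <= i1 <= i.+1)%N -> (j <= j1 <= j.+1)%N -> (i <= i2 <= i.+1)%N -> (j <= j2 <= j.+1)%N ->
     adjacent (psub (f (node N i1)) (g (node N j1))) (psub (f (node N i2)) (g (node N j2))).
Proof.
move=> cf cg apart.
(* The radius must be defined everywhere; outside the square it gets the dummy value 1. *)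
have loc s t : exists d : posreal, in01 s -> in01 t -> forall s1 t1 s2 t2,
    in01 s1 -> in01 t1 -> in01 s2 -> in01 t2 ->
    Rabs (s1 - s) < d -> Rabs (t1 - t) < d -> Rabs (s2 - s) < d -> Rabs (t2 - t) < d ->
    same_side (psub (f s1) (g t1)) (psub (f s2) (g t2)).
  case: (classic (in01 s /\ in01 t)) => [[s01 t01]|n01]; last first.
    by exists (mkposreal _ Rlt_0_1) => s01 t01; case: n01.
  by have [d Hd] := same_side_locally cf cg s01 t01 (apart _ _ s01 t01); exists d.
pose del s t := proj1_sig (constructive_indefinite_description _ (loc s t)).
have Hdel s t := proj2_sig (constructive_indefinite_description _ (loc s t)).
(* Half of the radius covers the distance to a centre, the other half the width of a grid cell. *)
have half s t : 0 < del s t / 2 by have := cond_pos (del s t); lra.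
have [d Hd] := Compactness.compactness_value_2d 0 1 0 1 (fun s t => mkposreal _ (half s t)).
have [N0 [HN0 N0_gt0]] := archimed_cor1 d (cond_pos d).
exists N0 => N le_N0N i j i1 j1 i2 j2 lt_iN lt_jN hi1 hj1 hi2 hj2.
have N_gt0 : (0 < N)%N by apply: leq_trans le_N0N; apply/ltP.
have RN_gt0 : 0 < INR N by apply: lt_0_INR; apply/ltP.
have invN : / INR N < d.
  apply: Rle_lt_trans HN0; apply: Rinv_le_contravar.
    exact: lt_0_INR.
  by apply: le_INR; apply/leP.
have in01_le k l : (k < N)%N -> (k <= l <= k.+1)%N -> in01 (node N l).
  by move=> lt_kN /andP[_ le_l]; apply: node01 => //; apply: leq_trans le_l lt_kN.
have close k l : (k <= l <= k.+1)%N -> Rabs (node N l - node N k) < d.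
  move=> /andP[/leP/le_INR h1 /leP/le_INR]; rewrite S_INR => h2.
  apply: Rle_lt_trans invN.
  have -> : node N l - node N k = (INR l - INR k) * / INR N by rewrite /node; field; lra.
  have := Rinv_0_lt_compat _ RN_gt0 => iN.
  rewrite Rabs_right; last by apply: Rle_ge; apply: Rmult_le_pos; lra.
  rewrite -[X in _ <= X]Rmult_1_l; apply: Rmult_le_compat_r; lra.
have kk k : (k <= k <= k.+1)%N by rewrite leqnn leqnSn.
have [u [v [hu [hv [hxu [hyv hdd]]]]]] :=
  NNPP _ (Hd _ _ (in01_le i i lt_iN (kk i)) (in01_le j j lt_jN (kk j))).
move: hxu hyv hdd => /= hxu hyv hdd.
apply: same_side_adjacent; apply: (Hdel u v) => //; rewrite -/(del u v).
- exact: in01_le lt_iN hi1.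
- exact: in01_le lt_jN hj1.
- exact: in01_le lt_iN hi2.
- exact: in01_le lt_jN hj2.
all: have tri x y z : Rabs (x - y) < d -> Rabs (y - z) < del u v / 2 -> Rabs (x - z) < del u v
  by move=> h1 h2; have -> : x - z = (x - y) + (y - z) by [ring]; apply: Rle_lt_trans (Rabs_triang _ _) _; lra.
- exact: tri (close _ _ hi1) hxu.
- exact: tri (close _ _ hj1) hyv.
- exact: tri (close _ _ hi2) hxu.
- exact: tri (close _ _ hj2) hyv.
Qed.

(** Gives one mesh fine enough for all pairs of independent edges at once. *)
Lemma finite_eventually (T : finType) (P : T -> nat -> Prop) :
  (forall x, exists N0, forall N, (N0 <= N)%N -> P x N) ->
  exists N0, forall N, (N0 <= N)%N -> forall x, P x N.
Proof.
move=> ev.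
have [N0 HN0] : exists N0, forall N, (N0 <= N)%N -> forall x, x \in enum T -> P x N.
  elim: (enum T) => [|y s [N1 IH]]; first by exists 0%N.
  have [N2 H2] := ev y; exists (maxn N1 N2) => N; rewrite geq_max => /andP[h1 h2] x.
  by rewrite inE => /orP[/eqP->|]; [apply: H2|apply: IH].
by exists N0 => N le_N x; apply: HN0 => //; rewrite mem_enum.
Qed.

End Sampling.

(** * The linking relation of a planar drawing *)

Section Linking.
Local Open Scope R_scope.

Definition linking (V : finType) (e : rel V) (q : V -> V -> Z) (th : V -> V -> V -> Z) :=
  [/\ forall x y, x <> y -> ((q x y - q y x) mod 4 = 2)%Z,
      forall x a b, e a b -> ((th x a b - (q x b - q x a)) mod 4 = 0)%Z &
      forall a b c d, e a b -> e c d -> a != c -> a != d -> b != c -> b != d ->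
        (th c a b + th b c d = th a c d + th d a b)%Z].

Lemma planar_linking (V : finType) (e : rel V) :
  planar e -> exists q th, linking e q th.
Proof.
move=> [p [arc [p_inj [arcP [arc_avoid arc_cross]]]]].
have arc_end a b t : e a b -> in01 t ->
    (t = 0 /\ arc a b t = p a) \/ (t = 1 /\ arc a b t = p b) \/ 0 < t < 1.
  move=> /arcP [_ [_ [h0 [h1 _]]]] [t0 t1].
  have [lt0|e0] := Rle_lt_or_eq_dec _ _ t0; last by left; rewrite -e0.
  by have [lt1|->] := Rle_lt_or_eq_dec _ _ t1; right; [right|left].
have apart a b c d : e a b -> e c d -> a != c -> a != d -> b != c -> b != d ->
    arcs_apart (arc a b) (arc c d).
  move=> eab ecd /eqP ac /eqP ad /eqP bc /eqP bd s t s01 t01.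
  have [[_ ->]|[[_ ->]|hs]] := arc_end _ _ _ eab s01.
  - have [[_ ->]|[[_ ->]|ht]] := arc_end _ _ _ ecd t01; try by move/p_inj.
    by apply/nesym; apply: arc_avoid.
  - have [[_ ->]|[[_ ->]|ht]] := arc_end _ _ _ ecd t01; try by move/p_inj.
    by apply/nesym; apply: arc_avoid.
  - have [[_ ->]|[[_ ->]|ht]] := arc_end _ _ _ ecd t01; try exact: arc_avoid.
    by move=> /arc_cross [] // [] *.
(* Quadruples other than independent pairs of edges are [fine] vacuously. *)
pose fine (Q : V * V * V * V) N := let: (a, b, c, d) := Q in
  e a b -> e c d -> a != c -> a != d -> b != c -> b != d ->
  forall i j i1 j1 i2 j2, (i < N)%N -> (j < N)%N ->
     (i <= i1 <= i.+1)%N -> (j <= j1 <= j.+1)%N -> (i <= i2 <= i.+1)%N -> (j <= j2 <= j.+1)%N ->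
     adjacent (psub (arc a b (node N i1)) (arc c d (node N j1)))
              (psub (arc a b (node N i2)) (arc c d (node N j2))).
have [Q|N0 HN0] := @finite_eventually _ fine.
  case: Q => [[[a b] c] d]; rewrite /fine.
  case: (classic (e a b /\ e c d /\ [&& a != c, a != d, b != c & b != d])); last first.
    by move=> nH; exists 0%N => N _ eab ecd ac ad bc bd; case: nH; rewrite ac ad bc bd.
  move=> [eab [ecd /and4P[ac ad bc bd]]].
  have [N1 H1] := same_side_fine (arcP _ _ eab).1 (arcP _ _ ecd).1 (apart _ _ _ _ eab ecd ac ad bc bd).
  by exists N1 => N le_N _ _ _ _ _ _; exact: H1 le_N.
pose N := N0.+1; have {}HN0 : forall Q, fine Q N by apply: HN0; apply: leqnSn.
exists (fun x y => quad (psub (p y) (p x))).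
exists (fun x a b => winding (fun i => psub (arc a b (node N i)) (p x)) N).
have [node0 nodeN] : node N 0 = 0 /\ node N N = 1 by apply: node_ends.
split.
- by move=> x y nxy; apply: quad_opp => /p_inj /esym.
- move=> x a b /arcP [_ [_ [h0 [h1 _]]]].
  have := winding_mod (fun i => psub (arc a b (node N i)) (p x)) N.
  by rewrite node0 nodeN h0 h1.
move=> a b c d eab ecd ac ad bc bd.
have := winding_grid (HN0 (a, b, c, d) eab ecd ac ad bc bd).
have [_ [_ [a0 [a1 _]]]] := arcP _ _ eab; have [_ [_ [c0 [c1 _]]]] := arcP _ _ ecd.
(* On two sides of the square the moving point is [p x] minus a point of cd; negation leaves all
   turns unchanged. *)
have flip x t0 : in01 t0 -> arc a b t0 = p x ->
   winding (fun j => psub (arc a b t0) (arc c d (node N j))) N =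
   winding (fun j => psub (arc c d (node N j)) (p x)) N.
  move=> t01 <-; apply: zsum_ext => j lt_jN.
  by rewrite turn_opp //; apply/nesym; apply: (apart a b c d) => //; apply: node01 => //; apply: ltnW.
rewrite node0 nodeN c0 c1 (flip a 0) //; last by rewrite /in01; lra.
by rewrite (flip b 1) // /in01; lra.
Qed.

End Linking.

(** * Nonplanarity of K_{3,3} *)

Section Walks.
Local Open Scope Z_scope.
Variables (V : finType) (e : rel V) (q : V -> V -> Z) (th : V -> V -> V -> Z).
Hypothesis lk : linking e q th.

Fixpoint walk_sum (x a : V) (w : seq V) : Z :=
  if w is b :: w' then th x a b + walk_sum x b w' else 0.

Lemma walk_sum_mod x a w : path e a w ->
  (walk_sum x a w - (q x (last a w) - q x a)) mod 4 = 0.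
Proof.
case: lk => _ th_mod _; elim: w a => [|b w IH] a /=; first by rewrite Z.sub_diag.
by move=> /andP[/(th_mod x) h /IH]; mod_lia.
Qed.

(** The edge relations are summed over all pairs of an edge of one walk and an edge of the other;
    intermediate terms cancel. *)
Lemma walk_sum_linking a w c z : path e a w -> path e c z ->
  ~~ has (mem (a :: w)) (c :: z) ->
  walk_sum c a w + walk_sum (last a w) c z = walk_sum a c z + walk_sum (last c z) a w.
Proof.
case: lk => _ _ th_link.
elim: w a => [|b w IHw] a /= pw pz; first by lia.
move: pw => /andP[eab pw] dis.
have dis' : ~~ has (mem (b :: w)) (c :: z).
  apply: contra dis => /hasP[x xz /= xw]; apply/orP.
  have : has (mem [:: a, b & w]) (c :: z) by apply/hasP; exists x => //=; rewrite inE xw orbT.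
  by move=> /= /orP.
suff edge : th c a b + walk_sum b c z = walk_sum a c z + th (last c z) a b.
  by have := IHw b pw pz dis'; lia.
have {dis'}dis : forall x, x \in c :: z -> (a != x) && (b != x).
  move=> x xz; apply: contraR dis; rewrite negb_and !negbK => abx.
  suff : has (mem [:: a, b & w]) (c :: z) by [].
  apply/hasP; exists x => //=; rewrite !inE; case/orP: abx => /eqP ->; rewrite eqxx ?orbT //.
elim: z c pz dis {IHw} => [|d z IHz] c /=; first by lia.
move=> /andP[ecd pz] dis.
have /andP[ac bc] := dis c (mem_head _ _).
have /andP[ad bd] : (a != d) && (b != d) by apply: dis; rewrite !inE eqxx orbT.
have := IHz d pz (fun x xz => dis x (@mem_behead _ (c :: d :: z) x xz)).
by have := th_link a b c d eab ecd ac ad bc bd; lia.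
Qed.

End Walks.

(** The walk [w i j], listed without its first vertex, stands for the edge from [a i] to [b j];
    independent edges differ in both indices. *)
Lemma k33_nonplanar (V : finType) (e : rel V) (a b : nat -> V) (w : nat -> nat -> seq V) :
  (forall i j, i < 3 -> j < 3 -> path e (a i) (w i j) && (last (a i) (w i j) == b j)) ->
  (forall i j i' j', i < 3 -> j < 3 -> i' < 3 -> j' < 3 -> i != i' -> j != j' ->
     ~~ has (mem (a i :: w i j)) (a i' :: w i' j')) ->
  ~ planar e.
Proof.
move=> wP dis /planar_linking [q [th lk]].
pose T x i j := walk_sum th x (a i) (w i j).
(* For indices below 3 this quotient is exact, whereas [m] leaves remainder 2 at distinct vertices:
   the source of the parity obstruction. *)
pose n x i j := ((T x i j - (q x (b j) - q x (a i))) / 4)%Z.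
pose m x y := ((q x y - q y x) / 4)%Z.
have Tn x i j : i < 3 -> j < 3 -> (T x i j = q x (b j) - q x (a i) + 4 * n x i j)%Z.
  move=> hi hj; have /andP[p1 /eqP l1] := wP i j hi hj.
  by have := walk_sum_mod lk x p1; rewrite l1 -/(T x i j) /n; mod_lia.
have link i j i' j' : i < 3 -> j < 3 -> i' < 3 -> j' < 3 -> i != i' -> j != j' ->
    (q (a i') (b j) - q (a i') (a i) + q (b j) (b j') - q (b j) (a i') + 4 * (n (a i') i j + n (b j) i' j') =
     q (a i) (b j') - q (a i) (a i') + q (b j') (b j) - q (b j') (a i) + 4 * (n (a i) i' j' + n (b j') i j))%Z.
  move=> hi hj hi' hj' ii' jj'.
  have /andP[p1 /eqP l1] := wP i j hi hj; have /andP[p2 /eqP l2] := wP i' j' hi' hj'.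
  have := walk_sum_linking lk p1 p2 (dis i j i' j' hi hj hi' hj' ii' jj').
  by rewrite l1 l2 -!/(T _ _ _) !Tn //; lia.
have disj i j i' j' x : i < 3 -> j < 3 -> i' < 3 -> j' < 3 -> i != i' -> j != j' ->
    x \in a i :: w i j -> x \in a i' :: w i' j' -> False.
  move=> hi hj hi' hj' ii' jj' xi xi'.
  by have /negP := dis i j i' j' hi hj hi' hj' ii' jj'; apply; apply/hasP; exists x.
have b_in i j : i < 3 -> j < 3 -> b j \in a i :: w i j.
  by move=> hi hj; have /andP[_ /eqP <-] := wP i j hi hj; apply: mem_last.
have qm x y : x <> y -> (q x y = q y x + 2 + 4 * m x y)%Z.
  by case: lk => h _ _ /h; rewrite /m; mod_lia.
have aa i i' : i < 3 -> i' < 3 -> i != i' -> a i <> a i'.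
  by move=> hi hi' ii' E; apply: (disj i 0 i' 1 (a i)); rewrite // ?E mem_head.
have ab i j : i < 3 -> j < 3 -> a i <> b j.
  move=> hi hj E.
  (* With these indices, [a i = b j] would lie on the disjoint walks [w i j'] and [w i' j]. *)
  pose i' := if i == 0 then 1 else 0; pose j' := if j == 0 then 1 else 0.
  have hi' : i' < 3 by rewrite /i'; case: (i == 0).
  have hj' : j' < 3 by rewrite /j'; case: (j == 0).
  have ii' : i != i' by rewrite /i'; case: (i).
  have jj' : j != j' by rewrite /j'; case: (j).
  by apply: (disj i j' i' j (a i)) => //; [rewrite eq_sym|apply: mem_head|rewrite E b_in].
(* Modulo 2, a quarter of the sum of the six relations between rows [i] and [i'] is [N i' - N i + 1]. *)
pose nb j i j' := n (b j) i j'.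
pose N i := (nb 0%N i 1%N + nb 0%N i 2%N + nb 1%N i 0%N + nb 1%N i 2%N + nb 2%N i 0%N + nb 2%N i 1%N)%Z.
(* Each count seen from [a i] or [a i'] occurs in two of the six relations and drops out modulo
   2. *)
have pair i i' : i < 3 -> i' < 3 -> i != i' -> exists r, (N i' - N i = 2 * r + 1)%Z.
  move=> hi hi' ii'.
  have := link i 0 i' 1 hi isT hi' isT ii' isT; have := link i 1 i' 0 hi isT hi' isT ii' isT.
  have := link i 0 i' 2 hi isT hi' isT ii' isT; have := link i 2 i' 0 hi isT hi' isT ii' isT.
  have := link i 1 i' 2 hi isT hi' isT ii' isT; have := link i 2 i' 1 hi isT hi' isT ii' isT.
  rewrite (qm _ _ (aa i i' hi hi' ii')) !(qm (a _) (b _)); try exact: ab.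
  move=> *; exists ((N i' - N i) / 2)%Z; rewrite /N /nb; mod_lia.
(* Three integers cannot have pairwise different parities. *)
have [r1 h1] := pair 0 1 isT isT isT; have [r2 h2] := pair 1 2 isT isT isT.
have [r3 h3] := pair 0 2 isT isT isT; lia.
Qed.

(** * Token graphs of small trees *)

Lemma planar_embedding (V W : finType) (e : rel V) (f : rel W) (phi : W -> V) :
  injective phi -> (forall x y, f x y -> e (phi x) (phi y)) -> planar e -> planar f.
Proof.
move=> phi_inj phiP [p [arc [p_inj [arcP [arc_avoid arc_cross]]]]].
exists (p \o phi), (fun u v => arc (phi u) (phi v)); split; first exact: inj_comp.
split; first by move=> u v /phiP/arcP.
split; first by move=> u v w t /phiP euv ht; apply: arc_avoid.
move=> u v x y s t /phiP euv /phiP exy hs ht /(arc_cross _ _ _ _ _ _ euv exy hs ht).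
by case=> -[/phi_inj -> /phi_inj ->]; [left|right].
Qed.

(** Complementation preserves symmetric differences, so it embeds one token graph into the other. *)
Lemma planar_token_compl (V : finType) (e : rel V) (k : nat) : k <= #|V| ->
  planar (token_rel V e k) -> planar (token_rel V e (#|V| - k)).
Proof.
move=> le_kV.
have cardC (A : ksubset V (#|V| - k)) : #|~: val A| == k.
  by rewrite cardsCs setCK (eqP (valP A)) subKn.
apply: (@planar_embedding _ _ _ _ (fun A => exist _ (~: val A) (cardC A))).
  by move=> A B /(congr1 val) /= /setC_inj /val_inj.
move=> A B; rewrite /token_rel /= => /existsP[x /existsP[y /andP[exy /eqP E]]].
apply/existsP; exists x; apply/existsP; exists y; rewrite exy -E /=.
by apply/eqP/setP => z; rewrite !inE !negbK orbC; congr orb; rewrite andbC.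
Qed.

(* Vertices of the small tree are numbered; [(i, j)] with [i < j] stands for two tokens at [i] and [j],
   and [E] lists each edge once. *)
Definition mem_edge (E : seq (nat * nat)) (x y : nat) : bool :=
  ((x, y) \in E) || ((y, x) \in E).

(** Pairs are ordered, so the resting token may be either entry before and after the move. *)
Definition pair_move (E : seq (nat * nat)) (p q : nat * nat) : bool :=
  [|| (p.1 == q.1) && mem_edge E p.2 q.2, (p.1 == q.2) && mem_edge E p.2 q.1,
      (p.2 == q.1) && mem_edge E p.1 q.2 | (p.2 == q.2) && mem_edge E p.1 q.1].

(* [w] lists, for the i-th vertex of [a] and the j-th vertex of [b], a walk between them without its
   first vertex. *)
Definition k33_walks (m : nat) (E : seq (nat * nat)) (a b : seq (nat * nat))
    (w : seq (seq (seq (nat * nat)))) : bool :=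
  let I := iota 0 3 in
  let W i j := nth (0, 0) a i :: nth [::] (nth [::] w i) j in
  all (fun i => all (fun j =>
    [&& all (fun p => p.1 < p.2 < m) (W i j),
        path (pair_move E) (nth (0, 0) a i) (behead (W i j)),
        last (nth (0, 0) a i) (behead (W i j)) == nth (0, 0) b j &
        all (fun i' => all (fun j' =>
          [|| i == i', j == j' | ~~ has (mem (W i j)) (W i' j')]) I) I]) I) I.

Lemma subset_of_card (V : finType) (A : {set V}) (k : nat) : k <= #|A| ->
  exists2 B : {set V}, B \subset A & #|B| = k.
Proof.
move=> le_kA; exists [set x in take k (enum A)].
  by apply/subsetP => x; rewrite inE => /mem_take; rewrite mem_enum.
rewrite cardsE; have /card_uniqP -> : uniq (take k (enum A)).
  by apply: take_uniq; apply: enum_uniq.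
by rewrite size_takel // -cardE.
Qed.

Lemma token_rel_slide (V : finType) (e : rel V) (k : nat) (A B : ksubset V k) (F : {set V}) (c x y : V) :
  e x y -> x != y -> c != x -> c != y -> x \notin F -> y \notin F ->
  val A = [set c; x] :|: F -> val B = [set c; y] :|: F -> token_rel V e k A B.
Proof.
move=> exy xy cx cy xF yF EA EB.
apply/existsP; exists x; apply/existsP; exists y; rewrite exy /= EA EB.
apply/eqP/setP => z; rewrite !inE.
have [->|zx] := eqVneq z x; first by rewrite (negbTE xy) eq_sym (negbTE cx) (negbTE xF) /= ?orbT.
have [->|zy] := eqVneq z y; first by rewrite eq_sym (negbTE cy) (negbTE yF) /= ?orbT.
by case: (z == c); case: (z \in F).
Qed.

(** * Two active tokens on a small tree, the others parked on [F] *)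

Section TwoTokens.
Variables (V : finType) (e : rel V) (v0 : V) (vs : seq V) (E : seq (nat * nat)).
Hypothesis e_simple : simple_graph e.
Hypothesis vs_uniq : uniq vs.
Hypothesis vsE : all (fun p => e (nth v0 vs p.1) (nth v0 vs p.2)) E.
Variables (k : nat) (F : {set V}).
Hypothesis FV : forall x, x \in F -> x \notin vs.
Hypothesis cardF : #|F| = k - 2.
Hypothesis k_ge2 : 2 <= k.

Let h := nth v0 vs.
Let tokens (p : nat * nat) : {set V} := [set h p.1; h p.2] :|: F.
Let valid (p : nat * nat) := p.1 < p.2 < size vs.

Let mem_edgeP x y : mem_edge E x y -> e (h x) (h y).
Proof. by case/orP => /(allP vsE) //=; rewrite (proj1 e_simple). Qed.

Let h_notin i : i < size vs -> h i \notin F.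
Proof. by move=> hi; apply/negP => /FV; rewrite mem_nth. Qed.

Let h_eq i j : i < size vs -> j < size vs -> (h i == h j) = (i == j).
Proof. by move=> hi hj; apply: nth_uniq. Qed.

Let card_tokens p : valid p -> #|tokens p| == k.
Proof.
move=> /andP[lt12 lt2]; have lt1 := ltn_trans lt12 lt2.
rewrite cardsU cards2 h_eq // (ltn_eqF lt12) /= cardF.
rewrite (_ : _ :&: F = set0) ?cards0 ?subn0 ?subnKC //.
apply/setP => x; rewrite !inE; apply/negP => /andP[/orP[] /eqP ->].
  by rewrite (negbTE (h_notin lt1)).
by rewrite (negbTE (h_notin lt2)).
Qed.

Let tokens_inj p q : valid p -> valid q -> tokens p = tokens q -> p = q.
Proof.
case: p q => [i j] [i' j'] /andP[/= ij js] /andP[/= ij' js'] /setP Epq.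
have is_ := ltn_trans ij js; have is' := ltn_trans ij' js'.
have /= := Epq (h i); have /= := Epq (h j); have /= := Epq (h i'); have /= := Epq (h j').
rewrite !inE !h_eq // !(negbTE (h_notin _)) // !eqxx ?orbT /= ?orbF.
move=> H1 H2 H3 H4; apply/eqP; rewrite xpair_eqE.
move: H1 H2 H3 H4 ij ij'; lia.
Qed.

Lemma k33_tokens_nonplanar a b w : k33_walks (size vs) E a b w ->
  ~ planar (token_rel V e k).
Proof.
move=> cert.
pose I := iota 0 3; pose W i j := nth (0, 0) a i :: nth [::] (nth [::] w i) j.
have {cert}certP i j : i < 3 -> j < 3 -> [&& all valid (W i j),
        path (pair_move E) (nth (0, 0) a i) (behead (W i j)),
        last (nth (0, 0) a i) (behead (W i j)) == nth (0, 0) b j &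
        all (fun i' => all (fun j' =>
          [|| i == i', j == j' | ~~ has (mem (W i j)) (W i' j')]) I) I].
  move=> hi hj; have iI : i \in iota 0 3 by rewrite mem_iota.
  have jI : j \in iota 0 3 by rewrite mem_iota.
  exact: (allP (allP cert i iI) j jI).
have valid00 : valid (nth (0, 0) a 0).
  by have /and4P[/andP[]] := certP 0 0 isT isT.
(* [A0] is the default value of [phi] at pairs that are not valid. *)
pose A0 : ksubset V k := exist (fun A : {set V} => #|A| == k) _ (card_tokens valid00).
pose phi p := insubd A0 (tokens p).
have phiE p : valid p -> val (phi p) = tokens p.
  by move=> vp; rewrite /phi insubdK //; apply: card_tokens.
have phi_move p q : valid p -> valid q -> pair_move E p q -> token_rel V e k (phi p) (phi q).
  move=> vp vq; have [Ep Eq] := (phiE _ vp, phiE _ vq).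
  case: p q vp vq Ep Eq => [i j] [i' j'] /andP[/= ij js] /andP[/= ij' js'] Ep Eq.
  have is_ := ltn_trans ij js; have is' := ltn_trans ij' js'.
  have ne x y : x < size vs -> y < size vs -> x != y -> h x != h y by move=> *; rewrite h_eq.
  have en x y : e (h x) (h y) -> h x != h y.
    by apply: contraTneq => ->; rewrite (proj2 e_simple).
  rewrite /tokens /= in Ep Eq; rewrite /pair_move /=.
  (* In each case the resting token is brought to the front of both sets. *)
  case/or4P => /andP[/eqP El /mem_edgeP ed]; subst.
  - by apply: (token_rel_slide ed (en _ _ ed) _ _ _ _ Ep Eq); rewrite ?ne ?h_notin //; lia.
  - rewrite [[set h i'; _]]setUC in Eq.
    by apply: (token_rel_slide ed (en _ _ ed) _ _ _ _ Ep Eq); rewrite ?ne ?h_notin //; lia.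
  - rewrite [[set h i; _]]setUC in Ep.
    by apply: (token_rel_slide ed (en _ _ ed) _ _ _ _ Ep Eq); rewrite ?ne ?h_notin //; lia.
  - rewrite [[set h i; _]]setUC in Ep; rewrite [[set h i'; _]]setUC in Eq.
    by apply: (token_rel_slide ed (en _ _ ed) _ _ _ _ Ep Eq); rewrite ?ne ?h_notin //; lia.
apply: (@k33_nonplanar _ _ (fun i => phi (nth (0, 0) a i)) (fun j => phi (nth (0, 0) b j))
         (fun i j => map phi (nth [::] (nth [::] w i) j))).
  move=> i j hi hj; have /and4P[vW pW /eqP lW _] := certP i j hi hj.
  rewrite last_map -lW eqxx andbT.
  move: vW pW; rewrite /W /=; elim: (nth [::] _ j) (nth (0, 0) a i) => //= q s IHs p.
  by move=> /and3P[vp vq vs'] /andP[mpq ps]; rewrite phi_move //= IHs ?vq.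
move=> i j i' j' hi hj hi' hj' ii' jj'.
have /and4P[/allP vW _ _ dW] := certP i j hi hj.
have /and4P[/allP vW' _ _ _] := certP i' j' hi' hj'.
have i'I : i' \in I by rewrite mem_iota.
have j'I : j' \in I by rewrite mem_iota.
have := allP (allP dW i' i'I) j' j'I; rewrite (negbTE ii') (negbTE jj') !orFb.
change (~~ has (mem (W i j)) (W i' j') -> ~~ has (mem (map phi (W i j))) (map phi (W i' j'))).
apply: contra => /hasP[_ /mapP[p pW ->] /mapP[q qW Epq]].
apply/hasP; exists p => //=.
have vp := vW' _ pW; have vq := vW _ qW.
by rewrite (tokens_inj vp vq) // -!phiE // Epq.
Qed.

End TwoTokens.

(** Parking requires [k - 2 <= #|V| - size vs]; the bound on [size vs] ensures this for [k] or for
    [#|V| - k]. *)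
Lemma subtree_nonplanar (V : finType) (e : rel V) (vs : seq V) (E : seq (nat * nat)) a b w k :
  simple_graph e -> uniq vs -> (forall v0, all (fun p => e (nth v0 vs p.1) (nth v0 vs p.2)) E) ->
  k33_walks (size vs) E a b w ->
  2 <= k <= #|V| - 2 -> 2 * size vs <= #|V| + 3 -> ~ planar (token_rel V e k).
Proof.
move=> e_simple vs_uniq vsE cert /andP[k_ge2 k_le] le_size.
have [v0 _|V0] := pickP (fun _ : V => true); last first.
  by move: k_ge2 k_le; rewrite (eq_card0 V0); lia.
wlog le_k : k k_ge2 k_le / size vs - 2 <= #|V| - k.
  move=> IH pl; have [le_k|lt_k] := leqP (size vs - 2) (#|V| - k); first exact: (IH k).
  have leV : k <= #|V| by lia.
  by apply: (IH (#|V| - k) _ _ _ (planar_token_compl leV pl)); lia.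
have card_vs : #|[set x in vs]| = size vs by rewrite cardsE; apply/card_uniqP.
have [|F FV cardF] := @subset_of_card V (~: [set x in vs]) (k - 2).
  by have := cardsC [set x in vs]; rewrite card_vs; lia.
apply: (@k33_tokens_nonplanar V e v0 vs E e_simple vs_uniq (vsE v0) k F _ cardF k_ge2 a b w cert).
by move=> x /(subsetP FV); rewrite !inE.
Qed.

(** * Trees that are not paths *)

(** A set that no edge leaves contains every path starting in it, hence all vertices. *)
Lemma boundary_edge (V : finType) (e : rel V) (s : seq V) :
  connected e -> s != [::] -> size s < #|V| ->
  exists u v, [/\ u \in s, v \notin s & e u v].
Proof.
case: s => // x s conn _ lt_s.
case: (boolP [exists u, exists v, [&& u \in x :: s, v \notin x :: s & e u v]]).
  by move=> /existsP[u /existsP[v /and3P[]]]; exists u, v.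
move=> /existsPn nex; suff all_in y : y \in x :: s.
  have /eq_card cardE : x :: s =i V by move=> y; rewrite all_in.
  by have := card_size (x :: s); rewrite cardE leqNgt lt_s.
have stay p w : w \in x :: s -> path e w p -> last w p \in x :: s.
  elim: p w => //= z p IHp w ws /andP[ewz zp]; apply: IHp zp.
  apply: contraTT ewz => zs; apply/negP => ewz.
  by have /negP := nex w; apply; apply/existsP; exists z; rewrite ws zs.
by have /connectP[p xp ->] := conn x y; apply: stay xp; apply: mem_head.
Qed.

Ltac split_uniq := repeat match goal with
  | H : is_true (uniq (_ :: _)) |- _ => move: H; rewrite /= ?inE ?negb_or; repeat move=> /andP[]; move=> *
  | H : is_true (_ && _) |- _ => move: H => /andP[? ?]
  end.
Ltac solve_uniq := split_uniq; rewrite /= ?inE ?negb_or;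
  repeat (apply/andP; split); solve [done | rewrite eq_sym; done].

(** The isomorphism is the position along [s]; an edge between non-consecutive positions would close
    a cycle. *)
Lemma hamilton_path_iso (V : finType) (e : rel V) (s : seq V) : is_tree e ->
  uniq s -> sorted e s -> #|V| <= size s -> isomorphic e (path_rel #|V|).
Proof.
move=> [[e_sym e_irr] [conn acyc]] s_uniq s_sorted ge_s.
have in_s x : x \in s.
  have : s =i V by apply/subset_cardP; [apply/eqP; rewrite eqn_leq max_card (card_uniqP s_uniq) | apply/subsetP].
  by move=> ->.
have lt_index x : index x s < #|V|.
  by apply: leq_trans (max_card (mem s)); rewrite (card_uniqP s_uniq) index_mem.
have chord x y : index x s < index y s -> e x y -> (index x s).+1 = index y s.
  move: (in_s y) (in_s x); move: (s) s_uniq s_sorted => {s ge_s in_s lt_index} s.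
  move=> s_uniq s_sorted ys xs; case/splitPr: s / xs s_uniq s_sorted ys => l r.
  rewrite cat_uniq sorted_cat_cons => /and3P[_ /= /norP[xl lr] xr_uniq] /andP[_ xr].
  rewrite !index_cat (negbTE xl) mem_cat !inE /= eqxx addn0.
  have [yl|_] := boolP (y \in l); first by rewrite ltnNge index_size.
  have [->|yx /= yr _ exy] := eqVneq y x; first by rewrite /= addn0 ltnn.
  case/splitPr: r / yr xr xr_uniq lr => m r2; rewrite cat_path cat_uniq /= index_cat /= eqxx.
  (* [m] lists the vertices strictly between x and y; if it is nonempty, the edge xy closes a
     cycle. *)
  case: m => [|z m] /=; first by rewrite addn1.
  move=> /andP[/andP[xz zm] /andP[zy _]] U _; exfalso.
  have := acyc (x :: rcons (z :: m) y) _ _; rewrite /= !size_rcons => /(_ isT).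
  rewrite !rcons_path last_rcons xz zm zy /= e_sym exy.
  move=> H; have // : ~~ true; apply: H; move: U => /and5P[xn /andP[zn um] /norP[yn _] _ _]; move: xn yn.
  rewrite !inE !mem_rcons !inE mem_cat !inE rcons_uniq !negb_or zn um (eq_sym z).
  by move=> /and4P[-> -> -> _] /andP[-> ->].
exists (fun x => Ordinal (lt_index x)); split.
  apply: inj_card_bij; last by rewrite card_ord.
  by move=> x y /(congr1 val) /=; apply: index_inj.
have edge x y : (index x s).+1 = index y s -> e x y.
  move=> E; have := elimT (sortedP x) s_sorted (index x s).
  by rewrite E index_mem !nth_index // in_s => ->.
move=> x y; rewrite /path_rel /=; apply/orP/idP => [[] /eqP E|exy].
- exact: edge.
- by rewrite e_sym; apply: edge.
have [lt|lt|E] := ltngtP (index x s) (index y s).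
- by left; apply/eqP/chord.
- by right; apply/eqP/chord; rewrite // e_sym.
- by move: exy; rewrite (index_inj x (in_s x) (in_s y) E) e_irr.
Qed.

(* A longest path misses a vertex adjacent to it, which by maximality is not attached to an end. *)
Lemma tree_claw (V : finType) (e : rel V) : is_tree e -> 0 < #|V| ->
  ~ isomorphic e (path_rel #|V|) ->
  exists c x1 x2 x3, [/\ uniq [:: c; x1; x2; x3], e c x1, e c x2 & e c x3].
Proof.
move=> tree V_gt0 nisop; have [[e_sym e_irr] [conn acyc]] := tree.
pose is_path (s : seq V) := uniq s && sorted e s.
have [s sP s_max] : exists2 s, is_path s & forall t, is_path t -> size t <= size s.
  pose Q n := [exists t : n.-tuple V, is_path t].
  have exQ : exists n, Q n by exists 0; apply/existsP; exists [tuple].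
  have boundQ n : Q n -> n <= #|V|.
    by move=> /existsP[t /andP[/card_uniqP Ut _]]; rewrite -(size_tuple t) -Ut max_card.
  have [n /existsP[s sP] n_max] := ex_maxnP exQ boundQ.
  exists s => // t tP; rewrite size_tuple; apply: n_max.
  by apply/existsP; exists (in_tuple t).
have /andP[s_uniq s_sorted] := sP.
have s_nil : s != [::].
  have /card_gt0P[x _] := V_gt0.
  by apply/eqP => s0; have := s_max [:: x] isT; rewrite s0.
have [lt_s|ge_s] := ltnP (size s) #|V|; last by case: nisop; apply: (hamilton_path_iso tree s_uniq).
have [c [x3 [cs x3s ecx3]]] := boundary_edge conn s_nil lt_s.
case/splitPr: s / cs sP s_max x3s s_uniq s_sorted {s_nil lt_s} => l r sP s_max x3s s_uniq.
rewrite sorted_cat_cons => /andP[s_l s_r].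
case/lastP: l => [|l x1] in sP s_max x3s s_uniq s_l *.
  suff /s_max : is_path (x3 :: c :: r) by rewrite /= ltnn.
  move: x3s s_uniq s_r; rewrite /is_path /= => -> -> ->.
  by rewrite e_sym ecx3.
case: r => [|x2 r] in sP s_max x3s s_uniq s_r *.
  suff /s_max : is_path (rcons l x1 ++ [:: c; x3]) by rewrite !size_cat /=; lia.
  rewrite /is_path sorted_cat_cons s_l /= ecx3 -[[:: c; x3]]/([:: c] ++ [:: x3]) catA.
  by rewrite cats1 rcons_uniq x3s s_uniq.
exists c, x1, x2, x3; move: s_l s_r; rewrite -cats1 cat_rcons sorted_cat_cons /=.
move=> /andP[_ /andP[ex1c _]] /andP[ecx2 _]; split => //; last by rewrite e_sym.
move: s_uniq x3s; rewrite cat_uniq rcons_uniq /= !mem_cat !mem_rcons !inE !negb_or => H1 H2; solve_uniq.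
Qed.

(** * Growing a claw under the assumption that the token graph is planar *)

Section Growth.
Variables (V : finType) (e : rel V) (k : nat).
Hypothesis e_simple : simple_graph e.
Hypothesis e_conn : connected e.
Hypothesis V_gt10 : 10 < #|V|.
Hypothesis k_ge2 : 2 <= k.
Hypothesis k_le : k <= #|V| - 2.
Hypothesis e_planar : planar (token_rel V e k).

Let e_sym : symmetric e := proj1 e_simple.

Let excluded (vs : seq V) E a b w : k33_walks (size vs) E a b w -> size vs <= 7 ->
  uniq vs -> (forall v0, all (fun p => e (nth v0 vs p.1) (nth v0 vs p.2)) E) -> False.
Proof.
move=> cert le_vs vs_uniq vsE.
by apply: (@subtree_nonplanar V e vs E a b w k) e_planar => //; rewrite ?k_ge2 //; lia.
Qed.

(** The states with a token at c form a K_6 whose edges are subdivided by the states with both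
    tokens on leaves. *)
Lemma no_star6 c x1 x2 x3 x4 x5 x6 : uniq [:: c; x1; x2; x3; x4; x5; x6] ->
  e c x1 -> e c x2 -> e c x3 -> e c x4 -> e c x5 -> e c x6 -> False.
Proof.
move=> U h1 h2 h3 h4 h5 h6.
apply: (@excluded _ [:: (0, 1); (0, 2); (0, 3); (0, 4); (0, 5); (0, 6)]
  [:: (0, 1); (0, 2); (0, 3)] [:: (0, 4); (0, 5); (0, 6)]
  [:: [:: [:: (1, 4); (0, 4)]; [:: (1, 5); (0, 5)]; [:: (1, 6); (0, 6)]];
      [:: [:: (2, 4); (0, 4)]; [:: (2, 5); (0, 5)]; [:: (2, 6); (0, 6)]];
      [:: [:: (3, 4); (0, 4)]; [:: (3, 5); (0, 5)]; [:: (3, 6); (0, 6)]]] _ _ U) => //= v0.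
by rewrite h1 h2 h3 h4 h5 h6.
Qed.

(** A claw times a path on three vertices contains a subdivided K_{3,3}. Here the claw at c with
    leaves x2, x3, x4 and the path y, x1, c share c; the state (0, 4) replaces the impossible one
    with both tokens at c. *)
Lemma no_spider2111 c x1 x2 x3 x4 y : uniq [:: c; x1; x2; x3; x4; y] ->
  e c x1 -> e c x2 -> e c x3 -> e c x4 -> e x1 y -> False.
Proof.
move=> U h1 h2 h3 h4 h5.
apply: (@excluded _ [:: (0, 1); (0, 2); (0, 3); (0, 4); (1, 5)]
  [:: (0, 1); (0, 4); (0, 5)] [:: (1, 2); (1, 3); (1, 4)]
  [:: [:: [:: (1, 2)]; [:: (1, 3)]; [:: (1, 4)]];
      [:: [:: (2, 4); (0, 2); (1, 2)]; [:: (3, 4); (0, 3); (1, 3)]; [:: (1, 4)]];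
      [:: [:: (2, 5); (1, 2)]; [:: (3, 5); (1, 3)]; [:: (4, 5); (1, 4)]]] _ _ U) => //= v0.
by rewrite h1 h2 h3 h4 h5.
Qed.

(** The claw at x1 with leaves c, y1, y2 and the path c, x2, z share c. In place of the state with
    both tokens at c, one token steps aside to x3. *)
Lemma no_double_claw_tail c x1 x2 x3 y1 y2 z : uniq [:: c; x1; x2; x3; y1; y2; z] ->
  e c x1 -> e c x2 -> e c x3 -> e x1 y1 -> e x1 y2 -> e x2 z -> False.
Proof.
move=> U h1 h2 h3 h4 h5 h6.
apply: (@excluded _ [:: (0, 1); (0, 2); (0, 3); (1, 4); (1, 5); (2, 6)]
  [:: (0, 1); (1, 2); (1, 6)] [:: (0, 2); (2, 4); (2, 5)]
  [:: [:: [:: (1, 3); (0, 3); (2, 3); (0, 2)]; [:: (0, 4); (2, 4)]; [:: (0, 5); (2, 5)]];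
      [:: [:: (0, 2)]; [:: (2, 4)]; [:: (2, 5)]];
      [:: [:: (0, 6); (0, 2)]; [:: (4, 6); (2, 4)]; [:: (5, 6); (2, 5)]]] _ _ U) => //= v0.
by rewrite h1 h2 h3 h4 h5 h6.
Qed.

(** One token moves on the claw at c, the other on the disjoint path z1, y, z2. *)
Lemma no_claws_at_distance2 c x1 x2 x3 y z1 z2 : uniq [:: c; x1; x2; x3; y; z1; z2] ->
  e c x1 -> e c x2 -> e c x3 -> e x1 y -> e y z1 -> e y z2 -> False.
Proof.
move=> U h1 h2 h3 h4 h5 h6.
apply: (@excluded _ [:: (0, 1); (0, 2); (0, 3); (1, 4); (4, 5); (4, 6)]
  [:: (0, 4); (0, 5); (0, 6)] [:: (1, 4); (2, 4); (3, 4)]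
  [:: [:: [:: (1, 4)]; [:: (2, 4)]; [:: (3, 4)]];
      [:: [:: (1, 5); (1, 4)]; [:: (2, 5); (2, 4)]; [:: (3, 5); (3, 4)]];
      [:: [:: (1, 6); (1, 4)]; [:: (2, 6); (2, 4)]; [:: (3, 6); (3, 4)]]] _ _ U) => //= v0.
by rewrite h1 h2 h3 h4 h5 h6.
Qed.

(** One token moves on the claw at c, the other on the disjoint path y, z, t. *)
Lemma no_spider411 c x1 x2 x3 y z t : uniq [:: c; x1; x2; x3; y; z; t] ->
  e c x1 -> e c x2 -> e c x3 -> e x1 y -> e y z -> e z t -> False.
Proof.
move=> U h1 h2 h3 h4 h5 h6.
apply: (@excluded _ [:: (0, 1); (0, 2); (0, 3); (1, 4); (4, 5); (5, 6)]
  [:: (0, 4); (0, 5); (0, 6)] [:: (1, 5); (2, 5); (3, 5)]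
  [:: [:: [:: (1, 4); (1, 5)]; [:: (2, 4); (2, 5)]; [:: (3, 4); (3, 5)]];
      [:: [:: (1, 5)]; [:: (2, 5)]; [:: (3, 5)]];
      [:: [:: (1, 6); (1, 5)]; [:: (2, 6); (2, 5)]; [:: (3, 6); (3, 5)]]] _ _ U) => //= v0.
by rewrite h1 h2 h3 h4 h5 h6.
Qed.

(** A further vertex attached at c gives a star with six leaves, at a leaf a spider with legs 2, 1,
    1, 1. *)
Lemma no_star5 c x1 x2 x3 x4 x5 : uniq [:: c; x1; x2; x3; x4; x5] ->
  e c x1 -> e c x2 -> e c x3 -> e c x4 -> e c x5 -> False.
Proof.
move=> U h1 h2 h3 h4 h5.
have [||u [v [us vs euv]]] := @boundary_edge V e [:: c; x1; x2; x3; x4; x5] e_conn; [done|exact: leq_trans V_gt10|].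
move: us vs; rewrite !inE !negb_or.
case/or3P => [/eqP Eu|/eqP Eu|/or4P[] /eqP Eu] vs; subst u.
- by apply: (@no_star6 c x1 x2 x3 x4 x5 v) => //; solve_uniq.
- by apply: (@no_spider2111 c x1 x2 x3 x4 v) => //; solve_uniq.
- by apply: (@no_spider2111 c x2 x1 x3 x4 v) => //; solve_uniq.
- by apply: (@no_spider2111 c x3 x1 x2 x4 v) => //; solve_uniq.
- by apply: (@no_spider2111 c x4 x1 x2 x3 v) => //; solve_uniq.
- by apply: (@no_spider2111 c x5 x1 x2 x3 v) => //; solve_uniq.
Qed.

Lemma no_star4 c x1 x2 x3 x4 : uniq [:: c; x1; x2; x3; x4] ->
  e c x1 -> e c x2 -> e c x3 -> e c x4 -> False.
Proof.
move=> U h1 h2 h3 h4.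
have [||u [v [us vs euv]]] := @boundary_edge V e [:: c; x1; x2; x3; x4] e_conn; [done|exact: leq_trans V_gt10|].
move: us vs; rewrite !inE !negb_or.
case/or3P => [/eqP Eu|/eqP Eu|/or3P[] /eqP Eu] vs; subst u.
- by apply: (@no_star5 c x1 x2 x3 x4 v) => //; solve_uniq.
- by apply: (@no_spider2111 c x1 x2 x3 x4 v) => //; solve_uniq.
- by apply: (@no_spider2111 c x2 x1 x3 x4 v) => //; solve_uniq.
- by apply: (@no_spider2111 c x3 x1 x2 x4 v) => //; solve_uniq.
- by apply: (@no_spider2111 c x4 x1 x2 x3 v) => //; solve_uniq.
Qed.

(** A further vertex gives c or x1 a fourth neighbour, or is a tail at a leaf; exchanging c and x1
    brings the tail to the side of c. *)
Lemma no_double_claw c x1 x2 x3 y1 y2 : uniq [:: c; x1; x2; x3; y1; y2] ->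
  e c x1 -> e c x2 -> e c x3 -> e x1 y1 -> e x1 y2 -> False.
Proof.
move=> U h1 h2 h3 h4 h5; have ex1c : e x1 c by rewrite e_sym.
have [||u [v [us vs euv]]] := @boundary_edge V e [:: c; x1; x2; x3; y1; y2] e_conn; [done|exact: leq_trans V_gt10|].
move: us vs; rewrite !inE !negb_or.
case/or3P => [/eqP Eu|/eqP Eu|/or4P[] /eqP Eu] vs; subst u.
- by apply: (@no_star4 c x1 x2 x3 v) => //; solve_uniq.
- by apply: (@no_star4 x1 c y1 y2 v) => //; solve_uniq.
- by apply: (@no_double_claw_tail c x1 x2 x3 y1 y2 v) => //; solve_uniq.
- by apply: (@no_double_claw_tail c x1 x3 x2 y1 y2 v) => //; solve_uniq.
- by apply: (@no_double_claw_tail x1 c y1 y2 x2 x3 v) => //; solve_uniq.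
- by apply: (@no_double_claw_tail x1 c y2 y1 x2 x3 v) => //; solve_uniq.
Qed.

Let spider c L1 L2 L3 :=
  [&& uniq (c :: L1 ++ L2 ++ L3), path e c L1, path e c L2, path e c L3,
      0 < size L1 <= 3, 0 < size L2 <= 3 & 0 < size L3 <= 3].

Let legs_rot (c : V) L1 L2 L3 : perm_eq (c :: L2 ++ L3 ++ L1) (c :: L1 ++ L2 ++ L3).
Proof. by rewrite perm_cons catA perm_catC. Qed.

Let spider_rot c L1 L2 L3 : spider c L1 L2 L3 -> spider c L2 L3 L1.
Proof.
case/and5P => U p1 p2 p3 /and3P[s1 s2 s3]; apply/and5P; split => //; last by apply/and3P.
by rewrite (perm_uniq (legs_rot _ _ _ _)).
Qed.

(** Only the end of a leg shorter than 3 can be extended; every other attachment creates an excluded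
    tree. *)
Let spider_grow c L1 L2 L3 u v : spider c L1 L2 L3 -> u \in L1 ->
  v \notin c :: L1 ++ L2 ++ L3 -> e u v -> spider c (rcons L1 v) L2 L3.
Proof.
case/and5P => U p1 p2 p3 /and3P[s1 s2 s3] uL vS euv.
(* Of the other two legs only the first vertices matter: with the first vertex of [L1] they form a
   claw. *)
have [b1 [c1 [cb1 cc1 sub]]] : exists b1 c1,
    [/\ e c b1, e c c1 & subseq (c :: L1 ++ [:: b1; c1]) (c :: L1 ++ L2 ++ L3)].
  case: L2 L3 p2 s2 p3 s3 {U vS} => [//|b1 L2] [//|c1 L3] /andP[cb1 _] _ /andP[cc1 _] _.
  exists b1, c1; split => //=; rewrite eqxx cat_subseq //.
  by rewrite -[[:: b1; c1]]/([:: b1] ++ [:: c1]) -cat_cons cat_subseq // sub1seq mem_head.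
have U' := subseq_uniq sub U.
have vS' : v \notin c :: L1 ++ [:: b1; c1] by apply: contra vS; apply: mem_subseq.
have grow : u = last c L1 -> size L1 <= 2 -> spider c (rcons L1 v) L2 L3.
  move=> Eu s12; apply/and5P; split => //; last by apply/and3P; rewrite size_rcons.
    have /permPl perm := perm_catCA (c :: L1) [:: v] (L2 ++ L3).
    by rewrite -cats1 -catA (perm_uniq perm); apply/andP.
  by rewrite rcons_path p1 -Eu euv.
case: L1 => [//|a1 [|a2 [|a3 [|//]]]] in U' p1 s1 uL vS' grow {U vS sub} *.
- by apply: grow => //; move: uL; rewrite inE => /eqP.
- move: uL p1; rewrite !inE /= => /orP[] /eqP Eu; last by move=> _; apply: grow.
  case/and3P=> ca1 a12 _; subst u; exfalso.
  by apply: (@no_double_claw c a1 b1 c1 a2 v) => //; rewrite /= !inE !negb_or in vS'; solve_uniq.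
- move: uL p1; rewrite !inE /= => /or3P[] /eqP Eu /and4P[ca1 a12 a23 _]; subst u; exfalso.
  + by apply: (@no_double_claw c a1 b1 c1 a2 v) => //; rewrite /= !inE !negb_or in vS'; solve_uniq.
  + by apply: (@no_claws_at_distance2 c a1 b1 c1 a2 a3 v) => //; rewrite /= !inE !negb_or in vS'; solve_uniq.
  + by apply: (@no_spider411 c a1 b1 c1 a2 a3 v) => //; rewrite /= !inE !negb_or in vS'; solve_uniq.
Qed.

Let no_spider c L1 L2 L3 : spider c L1 L2 L3 -> False.
Proof.
(* Induction on how many vertices the legs can still gain; even a full spider has only 10 vertices,
   so some edge leaves it. *)
have [d] := ubnP (9 - (size L1 + size L2 + size L3)).
elim: d L1 L2 L3 => // d IH L1 L2 L3 le_d S.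
have /and5P[U p1 p2 p3 /and3P[s1 s2 s3]] := S.
have lt_size : size (c :: L1 ++ L2 ++ L3) < #|V|.
  apply: leq_trans V_gt10; rewrite /= !size_cat !ltnS.
  have le3 K : 0 < size K <= 3 -> size K <= 3 by case/andP.
  by apply: (@leq_add _ _ 3 6); [exact: le3|apply: (@leq_add _ _ 3 3); exact: le3].
have [u [v [us vs euv]]] := @boundary_edge V e (c :: _) e_conn isT lt_size.
have step K1 K2 K3 : spider c K1 K2 K3 -> size K1 + size K2 + size K3 = size L1 + size L2 + size L3 ->
    u \in K1 -> v \notin c :: K1 ++ K2 ++ K3 -> False.
  move=> SK EK uK vK; have SK' := spider_grow SK uK vK euv.
  apply: (IH _ _ _ _ SK'); move: le_d; rewrite -EK size_rcons !addSn ltnS.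
  have /and5P[_ _ _ _ /and3P[/andP[_ le1] /andP[_ le2] /andP[_ le3]]] := SK'.
  by rewrite subnSK //; move: le1; rewrite size_rcons => le1; apply: leq_add (leq_add le1 le2) le3.
have S2 := spider_rot S; have S3 := spider_rot S2.
move: us; rewrite inE !mem_cat => /or4P[/eqP Eu|uL|uL|uL].
(* Attached at the centre, v is a fourth neighbour of c. *)
- subst u.
  case: L1 L2 L3 p1 p2 p3 s1 s2 s3 U vs {IH S S2 S3 step le_d lt_size} =>
    [//|a1 L1] [//|b1 L2] [//|c1 L3] /andP[ca1 _] /andP[cb1 _] /andP[cc1 _] _ _ _ U vs.
  apply: (@no_star4 c a1 b1 c1 v) => //.
  have sub : subseq [:: c; a1; b1; c1] (c :: (a1 :: L1) ++ (b1 :: L2) ++ c1 :: L3).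
    rewrite /= !eqxx; apply: subseq_trans (suffix_subseq L1 _); rewrite /= eqxx.
    by apply: subseq_trans (suffix_subseq L2 _); rewrite /= eqxx sub0seq.
  have U' := subseq_uniq sub U.
  have vS' : v \notin [:: c; a1; b1; c1] by apply: contra vs; apply: mem_subseq.
  by rewrite !inE !negb_or in vS'; solve_uniq.
- exact: (step L1 L2 L3).
- by apply: (step L2 L3 L1) => //; [rewrite addnC addnA|rewrite (perm_mem (legs_rot _ _ _ _))].
- by apply: (step L3 L1 L2) => //; [rewrite -addnA addnC|rewrite 2!(perm_mem (legs_rot _ _ _ _))].
Qed.

Lemma no_claw c x1 x2 x3 : uniq [:: c; x1; x2; x3] -> e c x1 -> e c x2 -> e c x3 -> False.
Proof.
move=> U h1 h2 h3; apply: (@no_spider c [:: x1] [:: x2] [:: x3]).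
by apply/and5P; split; rewrite //= ?h1 ?h2 ?h3.
Qed.

End Growth.

Theorem theorem7 (V : finType) (e : rel V) :
  is_tree e -> 10 < #|V| -> ~ isomorphic e (path_rel #|V|) ->
  forall k : nat, 2 <= k <= #|V| - 2 -> ~ planar (token_rel V e k).
Proof.
move=> tree V_gt10 nisop k /andP[k_ge2 k_le] pl.
have [c [x1 [x2 [x3 [U h1 h2 h3]]]]] := tree_claw tree (ltn_trans (isT : 0 < 10) V_gt10) nisop.
have [e_simple [e_conn _]] := tree.
exact: (no_claw e_simple e_conn V_gt10 k_ge2 k_le pl U h1 h2 h3).
Qed.
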